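(* Let $(E,\rho,[\cdot,\cdot]_E,L)$ be a regular local pre-Leibniz algebroid over $M$ with a locality projector $\mathcal{P}$, and let $(g,\nabla,\nabla^* )$ be a conjugate $E$-connection structure such that the two projected modified brackets $[\cdot,\cdot]_E^{\widehat{\nabla}}$ and $[\cdot,\cdot]_E^{\widehat{\nabla^*}}$ share a holonomic local $E$-frame, i.e. around each point of $M$ there is a local frame $(X_a)$ of $E$ with $[X_a,X_b]_E^{\widehat{\nabla}}=0=[X_a,X_b]_E^{\widehat{\nabla^*}}$ for all $a,b$. Then $$g(R(\nabla)(u, v)w, z) + g(R(\nabla^* )(u, v)z, w) = 0$$ for all $u,v,w,z\in\mathfrak{X}(E)$.
   Context: Everything is smooth; $M$ is an orientable, paracompact, Hausdorff smooth manifold, $E\to M$ a real vector bundle, $\mathfrak{X}(E)=\Gamma(E)$, $\Omega^1(E)=\Gamma(E^* )$. An anchored vector bundle $(E,\rho)$ is a vector bundle $E$ with a vector bundle morphism $\rho:E\to T(M)$ over the identity; it is regular if $\rho$ has locally constant rank. A linear $E$-connection is an $\mathbb{R}$-bilinear map $\nabla:\mathfrak{X}(E)\times\mathfrak{X}(E)\to\mathfrak{X}(E)$ with $\nabla_u(fv)=\rho(u)(f)v+f\nabla_u v$ and $\nabla_{fu}v=f\nabla_u v$. An $E$-metric is a symmetric non-degenerate section $g$ of $E^*\otimes E^*$. A conjugate $E$-connection structure is a triplet $(g,\nabla,\nabla^* )$ with $g$ an $E$-metric and $\nabla,\nabla^*$ linear $E$-connections with $\rho(u)(g(v,w))=g(\nabla_u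 v,w)+g(v,\nabla^*_u w)$ for all $u,v,w$. A local almost-Leibniz algebroid $(E,\rho,[\cdot,\cdot]_E,L)$ is an anchored vector bundle with an $\mathbb{R}$-bilinear bracket $[\cdot,\cdot]_E$ on $\mathfrak{X}(E)$ and a $C^\infty(M,\mathbb{R})$-multilinear map $L:\Omega^1(E)\times\mathfrak{X}(E)\times\mathfrak{X}(E)\to\mathfrak{X}(E)$ with $[u,fv]_E=\rho(u)(f)v+f[u,v]_E$ and $[fu,v]_E=-\rho(v)(f)u+f[u,v]_E+L(Df,u,v)$, where $(Df)(u):=\rho(u)(f)$. It is a local pre-Leibniz algebroid if moreover $\rho([u,v]_E)=[\rho(u),\rho(v)]$. A locality projector is a $C^\infty(M,\mathbb{R})$-linear map $\mathcal{P}:\mathfrak{X}(E)\to\mathfrak{X}(E)$ such that the image of $\widehat{L}:=\mathcal{P}L$ lies in the kernel of $\rho$, and $\mathcal{P}$ restricted to the kernel of $\rho$ is the identity. The projected modified bracket is $[u,v]_E^{\widehat{\nabla}}:=[u,v]_E-\widehat{L}(e^a,\nabla_{X_a}u,v)$ (sum over $a$; $(X_a)$ any local frame of $E$ with dual coframe $(e^a)$). The $E$-curvature is $R(\nabla)(u,v)w:=\nabla_u\nabla_v w-\nabla_v\nabla_u w-\nabla_{[u,v]_E^{\widehat{\nabla}}}w$ (it is $C^\infty(M,\mathbb{R})$-multilinear). *)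

(* Defs.v *)
From HB Require Import structures.
From mathcomp Require Import all_boot all_order all_algebra.
From mathcomp Require Import all_classical all_reals all_analysis.
Set Implicit Arguments.
Unset Strict Implicit.
Unset Printing Implicit Defensive.
Import Order.TTheory GRing.Theory Num.Theory.
Import numFieldNormedType.Exports.
Local Open Scope classical_set_scope.
Local Open Scope ring_scope.

Section Calculus.
Context {R : realType} {V W : normedModType R}.

(* Of class C^k on the open set [U]: differentiability together with all
   directional derivatives being of class C^(k-1). *)
Fixpoint Ck (k : nat) (U : set V) (f : V -> W) : Prop :=
  if k is k'.+1
  then (forall x, U x -> differentiable f x) /\ (forall v, Ck k' U ('D_v f))
  else forall x, U x -> {for x, continuous f}.

Definition Cinf (U : set V) (f : V -> W) : Prop := forall k, Ck k U f.

End Calculus.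

Section Choice.
Context {T : Type}.

Definition pick_or (d : T) (P : T -> Prop) : T :=
  if pselect (exists t, P t) is left h then projT1 (cid h) else d.

End Choice.

Section Manifolds.
Context {R : realType}.

(* A homeomorphism from the open set [cdom] onto an open subset of R^n; the
   values of [cmap] outside [cdom] and of [cinv] outside the image are junk. *)
Record chart (M : topologicalType) (n : nat) := Chart {
  cdom : set M;
  cmap : M -> 'rV[R]_n;
  cinv : 'rV[R]_n -> M;
  cdom_open : open cdom;
  cimg_open : open (cmap @` cdom);
  cmapK : forall x, cdom x -> cinv (cmap x) = x;
  cmap_continuous : forall x, cdom x -> {for x, continuous cmap};
  cinv_continuous : forall y, (cmap @` cdom) y -> {for y, continuous cinv} }.

Definition smooth_transition (M : topologicalType) (n : nat)
    (c d : chart M n) : Prop :=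
  Cinf (cmap c @` (cdom c `&` cdom d)) (cmap d \o cinv c).

Record smooth_manifold (n : nat) := SmoothManifold {
  mcarrier :> topologicalType;
  matlas : set (chart mcarrier n);
  matlas_cover : forall x, exists2 c, matlas c & cdom c x;
  matlas_compat : forall c d, matlas c -> matlas d -> smooth_transition c d }.

Definition paracompact (M : topologicalType) : Prop :=
  forall C : set (set M),
    (forall A, C A -> open A) -> (forall x, exists2 A, C A & A x) ->
  exists D : set (set M),
    [/\ forall B, D B -> open B,
        forall x, exists2 B, D B & B x,
        forall B, D B -> exists2 A, C A & B `<=` A &
        forall x : M, exists2 N, nbhs x N &
          finite_set [set B | D B /\ B `&` N !=set0]].

(* There is an oriented atlas for the given smooth structure. *)
Definition orientable (n : nat) (M : smooth_manifold n) : Prop :=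
  exists O : set (chart M n),
    [/\ forall x, exists2 c, O c & cdom c x,
        forall c d, O c -> matlas d ->
          smooth_transition c d /\ smooth_transition d c &
        forall c d, O c -> O d -> forall x, cdom c x -> cdom d x ->
          0 < \det ('J (cmap d \o cinv c) (cmap c x))].

(* Meaningful for [U] open. *)
Definition smooth_on (n : nat) (M : smooth_manifold n) (W : normedModType R)
    (U : set M) (f : M -> W) : Prop :=
  forall c, matlas c -> Cinf (cmap c @` (cdom c `&` U)) (f \o cinv c).

Definition smooth_fun (n : nat) (M : smooth_manifold n) (f : M -> R) : Prop :=
  smooth_on setT f.

End Manifolds.

Section Bundles.
Context {R : realType} {n : nat} {M : smooth_manifold (R := R) n}.

Record local_triv (F : M -> lmodType R) (r : nat) := LocalTriv {
  tdom : set M;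
  tmap : forall x, F x -> 'rV[R]_r;
  tinv : forall x, 'rV[R]_r -> F x;
  tdom_open : open tdom;
  tmap_linear : forall x, tdom x -> linear (@tmap x);
  tmapK : forall x, tdom x -> cancel (@tmap x) (tinv x);
  tinvK : forall x, tdom x -> cancel (tinv x) (@tmap x) }.

(* A family of vector spaces with local trivializations whose transition
   functions are smooth; this determines the manifold structure of the total
   space. As the transition functions are fibrewise linear, smoothness is
   tested on each fixed vector of R^r. *)
Record vector_bundle (r : nat) := VectorBundle {
  fibre :> M -> lmodType R;
  trivs : set (local_triv fibre r);
  trivs_cover : forall x, exists2 t, trivs t & tdom t x;
  trivs_compat : forall s t, trivs s -> trivs t -> forall v : 'rV[R]_r,
    smooth_on (tdom s `&` tdom t) (fun x => tmap t (tinv s x v)) }.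

Context {r : nat} {E : vector_bundle r}.

Definition section : Type := forall x : M, E x.

Definition smooth_section_on (U : set M) (u : section) : Prop :=
  forall t, trivs t -> smooth_on (tdom t `&` U) (fun x => tmap t (u x)).

(* [smooth_section u] says that [u] belongs to X(E). Operators on X(E) are
   below functions on all set-theoretic sections which preserve smoothness;
   their values on non-smooth sections are never used. *)
Definition smooth_section (u : section) : Prop := smooth_section_on setT u.

Definition form : Type := forall x : M, E x -> R.

Definition smooth_form_on (U : set M) (w : form) : Prop :=
  (forall x, U x -> scalar (w x)) /\
  (forall t, trivs t -> forall v : 'rV[R]_r,
     smooth_on (tdom t `&` U) (fun x => w x (tinv t x v))).

Definition smooth_form (w : form) : Prop := smooth_form_on setT w.

(* The tangent space at [x] is the space of derivations at [x] of the algebra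
   of smooth functions; values on non-smooth functions are irrelevant. *)
Definition derivation_at (x : M) (D : (M -> R) -> R) : Prop :=
  (forall (a : R) f h, smooth_fun f -> smooth_fun h ->
     D (fun y => a * f y + h y) = a * D f + D h) /\
  (forall f h, smooth_fun f -> smooth_fun h ->
     D (fun y => f y * h y) = D f * h x + f x * D h).

(* A morphism E -> TM over the identity: [rho x e] is a tangent vector at [x],
   linear in [e], and [rho] maps smooth local sections to smooth vector
   fields. *)
Record anchor := Anchor {
  anchor_fun :> forall x : M, E x -> (M -> R) -> R;
  anchor_derivation : forall x e, derivation_at x (@anchor_fun x e);
  anchor_scalar : forall x f, smooth_fun f ->
    scalar (fun e => @anchor_fun x e f);
  anchor_smooth : forall t, trivs t -> forall (v : 'rV[R]_r) f, smooth_fun f ->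
    smooth_on (tdom t) (fun x => @anchor_fun x (tinv t x v) f) }.

(* The image of E_x has a basis with [k] elements. *)
Definition anchor_rank (rho : anchor) (x : M) (k : nat) : Prop :=
  exists b : 'I_k -> E x,
    (forall c : 'I_k -> R,
       (forall f, smooth_fun f -> \sum_i c i * rho x (b i) f = 0) ->
       forall i, c i = 0) /\
    (forall e : E x, exists c : 'I_k -> R,
       forall f, smooth_fun f -> rho x e f = \sum_i c i * rho x (b i) f).

Definition regular (rho : anchor) : Prop :=
  forall x : M, exists k, \forall y \near x, anchor_rank rho y k.

Definition act (rho : anchor) (u : section) (f : M -> R) : M -> R :=
  fun x => rho x (u x) f.

Definition in_kernel (rho : anchor) (u : section) : Prop :=
  forall f, smooth_fun f -> forall x, act rho u f x = 0.

Definition coboundary (rho : anchor) (f : M -> R) : form :=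
  fun x e => rho x e f.

Record metric := Metric {
  metric_fun :> forall x : M, E x -> E x -> R;
  metric_scalar : forall x v, scalar (fun u => @metric_fun x u v);
  metric_sym : forall x u v, @metric_fun x u v = @metric_fun x v u;
  metric_nondegenerate : forall x u,
    (forall v, @metric_fun x u v = 0) -> u = 0;
  metric_smooth : forall t, trivs t -> forall v w : 'rV[R]_r,
    smooth_on (tdom t) (fun x => @metric_fun x (tinv t x v) (tinv t x w)) }.

Definition pairing (g : metric) (u v : section) : M -> R :=
  fun x => g x (u x) (v x).

Definition combine (f : M -> R) (u v : section) : section :=
  fun x => f x *: u x + v x.

Definition combine_form (f : M -> R) (w h : form) : form :=
  fun x e => f x * w x e + h x e.

Definition endo_op : Type := section -> section.
Definition binary_op : Type := section -> section -> section.
Definition locality_op : Type := form -> section -> section -> section.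

Definition R_bilinear (B : binary_op) : Prop :=
  [/\ forall u v, smooth_section u -> smooth_section v ->
        smooth_section (B u v),
      forall (a : R) u u' v,
        smooth_section u -> smooth_section u' -> smooth_section v ->
        B (combine (fun=> a) u u') v = combine (fun=> a) (B u v) (B u' v) &
      forall (a : R) u v v',
        smooth_section u -> smooth_section v -> smooth_section v' ->
        B u (combine (fun=> a) v v') = combine (fun=> a) (B u v) (B u v')].

Definition Cinf_linear (P : endo_op) : Prop :=
  (forall u, smooth_section u -> smooth_section (P u)) /\
  (forall f u v, smooth_fun f -> smooth_section u -> smooth_section v ->
     P (combine f u v) = combine f (P u) (P v)).

Definition Cinf_multilinear (L : locality_op) : Prop :=
  [/\ forall w u v, smooth_form w -> smooth_section u -> smooth_section v ->
        smooth_section (L w u v),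
      forall f w w' u v, smooth_fun f -> smooth_form w -> smooth_form w' ->
        smooth_section u -> smooth_section v ->
        L (combine_form f w w') u v = combine f (L w u v) (L w' u v),
      forall w u, smooth_form w -> smooth_section u -> Cinf_linear (L w u) &
      forall w v, smooth_form w -> smooth_section v ->
        Cinf_linear (fun u => L w u v)].

Definition linear_connection (rho : anchor) (nabla : binary_op) : Prop :=
  [/\ R_bilinear nabla,
      forall f u v, smooth_fun f -> smooth_section u -> smooth_section v ->
        forall x, nabla u (fun y => f y *: v y) x
                  = act rho u f x *: v x + f x *: nabla u v x &
      forall f u v, smooth_fun f -> smooth_section u -> smooth_section v ->
        forall x, nabla (fun y => f y *: u y) v x = f x *: nabla u v x].

Definition conjugate_structure (rho : anchor) (g : metric)
    (nabla nablas : binary_op) : Prop :=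
  [/\ linear_connection rho nabla,
      linear_connection rho nablas &
      forall u v w, smooth_section u -> smooth_section v -> smooth_section w ->
        forall x, act rho u (pairing g v w) x
                  = pairing g (nabla u v) w x + pairing g v (nablas u w) x].

Definition local_almost_leibniz (rho : anchor) (B : binary_op)
    (L : locality_op) : Prop :=
  [/\ R_bilinear B,
      Cinf_multilinear L,
      forall f u v, smooth_fun f -> smooth_section u -> smooth_section v ->
        forall x, B u (fun y => f y *: v y) x
                  = act rho u f x *: v x + f x *: B u v x &
      forall f u v, smooth_fun f -> smooth_section u -> smooth_section v ->
        forall x, B (fun y => f y *: u y) v x
                  = - (act rho v f x *: u x) + f x *: B u v x
                    + L (coboundary rho f) u v x].

Definition local_pre_leibniz (rho : anchor) (B : binary_op)
    (L : locality_op) : Prop :=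
  local_almost_leibniz rho B L /\
  (forall u v f, smooth_section u -> smooth_section v -> smooth_fun f ->
     forall x, act rho (B u v) f x
               = act rho u (act rho v f) x - act rho v (act rho u f) x).

Definition locality_projector (rho : anchor) (L : locality_op)
    (P : endo_op) : Prop :=
  [/\ Cinf_linear P,
      forall w u v, smooth_form w -> smooth_section u -> smooth_section v ->
        in_kernel rho (P (L w u v)) &
      forall u, smooth_section u -> in_kernel rho u -> P u = u].

(* Operators on X(E) act on local sections and forms because they are local:
   at [x] they are evaluated on any global smooth section or form with the same
   germ at [x]. *)
Definition extend (x : M) (s : section) : section :=
  pick_or s (fun t => smooth_section t /\ \forall y \near x, t y = s y).

Definition extend_form (x : M) (w : form) : form :=
  pick_or w (fun h => smooth_form h /\ \forall y \near x, h y = w y).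

Definition local_frame (U : set M) (X : 'I_r -> section) : Prop :=
  [/\ open U,
      forall a, smooth_section_on U (X a) &
      forall x, U x -> forall e : E x,
        exists! c : 'I_r -> R, e = \sum_a c a *: X a x].

Definition dual_coframe (U : set M) (X : 'I_r -> section)
    (w : 'I_r -> form) : Prop :=
  forall a, smooth_form_on U (w a) /\
    forall x, U x -> forall b, w a x (X b x) = (a == b)%:R.

(* A local frame around [x] together with its dual coframe; the default value
   is never used, since a local trivialization provides such a pair. *)
Definition framing (x : M) : ('I_r -> section) * ('I_r -> form) :=
  pick_or ((fun _ _ => 0), (fun _ _ _ => 0))
    (fun p => exists U : set M,
       [/\ U x, local_frame U p.1 & dual_coframe U p.1 p.2]).

Definition projected_bracket (B : binary_op) (L : locality_op) (P : endo_op)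
    (nabla : binary_op) : binary_op :=
  fun u v x =>
    let: (X, w) := framing x in
    B u v x
    - \sum_a P (L (extend_form x (w a)) (nabla (extend x (X a)) u) v) x.

Definition holonomic (K : binary_op) (U : set M) (X : 'I_r -> section) : Prop :=
  forall a b x, U x -> K (extend x (X a)) (extend x (X b)) x = 0.

Definition curvature (B : binary_op) (L : locality_op) (P : endo_op)
    (nabla : binary_op) (u v w : section) : section :=
  fun x => nabla u (nabla v w) x - nabla v (nabla u w) x
           - nabla (projected_bracket B L P nabla u v) w x.

End Bundles.

Arguments vector_bundle {R n} M r.
Arguments section {R n M r} E.
Arguments form {R n M r} E.
Arguments anchor {R n M r} E.
Arguments metric {R n M r} E.
Arguments endo_op {R n M r} E.
Arguments binary_op {R n M r} E.
Arguments locality_op {R n M r} E.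
Arguments smooth_manifold R n : clear implicits.

(* Main.v *)
(* Antisymmetrising the compatibility of g with (nabla, nablas) twice expresses
   g(R(nabla)(u,v)w,z) + g(R(nablas)(u,v)z,w) as
     rho([u,v])(g(w,z)) - g(nabla_K w, z) - g(w, nablas_K' z),
   where K and K' are the two projected brackets of u and v. Since the correction
   terms of the brackets lie in the kernel of rho, rho([u,v]) = rho(K), so the sum
   vanishes as soon as K = K'. The difference K - K' involves only the tensor
   nabla - nablas, hence is tensorial in u and v, and it vanishes on the shared
   holonomic frames. Bump functions give the passage from tensoriality to values
   at a point, the smoothness of K, and the global extensions of local frames. *)
Require Import Defs.
From HB Require Import structures.
From mathcomp Require Import all_boot all_order all_algebra.
From mathcomp Require Import all_classical all_reals all_analysis.
From mathcomp Require Import ring lra.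
Set Implicit Arguments.
Unset Strict Implicit.
Unset Printing Implicit Defensive.
Import Order.TTheory GRing.Theory Num.Theory.
Import numFieldNormedType.Exports.
Local Open Scope classical_set_scope.
Local Open Scope ring_scope.

(** * Functions of class C^k *)

Section CkTheory.
Context {R : realType}.
Implicit Types V W : normedModType R.

(** The first-order expansion of [f] at [x] is also one of [g], because both maps agree near [x];
    uniqueness of the differential then identifies ['d g x] with ['d f x]. *)
Lemma near_eq_differentiable V W (f g : V -> W) x :
  (\near x, f x = g x) -> differentiable f x -> differentiable g x.
Proof.
move=> fg /diff_locallyP[dc df].
have dg : g \o shift x = cst (g x) + 'd f x +o_ 0 id.
  apply/eqaddoP => _/posnumP[e].
  have /eqaddoP/(_ e%:num ltac:(done)) fe := df.
  have fg0 : \forall y \near (0 : V), f (y + x) = g (y + x).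
    rewrite (near_shift x 0)/=; near=> y; rewrite /= sub0r subrK; near: y.
    exact: fg.
  near=> y.
  rewrite /= !fctE/= -(nbhs_singleton fg).
  have <- : f (y + x) = g (y + x) by near: y.
  near: y; exact: fe.
by apply/diff_locallyP; rewrite (diff_unique dc dg).
Unshelve. all: by end_near. Qed.

(** The product rule: scaling is a continuous bilinear map, here composed with the pair [(f, h)]. *)
Lemma diff_scale V W (f : V -> R) (h : V -> W) x :
  differentiable f x -> differentiable h x ->
  differentiable (fun y => f y *: h y) x /\
  (forall v, 'D_v (fun y => f y *: h y) x = f x *: 'D_v h x + 'D_v f x *: h x).
Proof.
move=> df dh.
have biP : bilinear_for
    (GRing.Scale.Law.clone _ _ *:%R _) (GRing.Scale.Law.clone _ _ *:%R _)
    (@GRing.scale R W : R -> W -> W).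
  split=> [u'|u] a y z /=; first by rewrite scalerDl scalerA.
  by rewrite scalerDr !scalerA mulrC.
pose biM :=
  bilinear_isBilinear.Build R R W W _ _ (@GRing.scale R W : R -> W -> W) biP.
pose bi : {bilinear R -> W -> W} :=
  HB.pack (@GRing.scale R W : R -> W -> W) biM.
have bic : continuous (fun p : R * W => bi p.1 p.2) by exact: scale_continuous.
have E : (fun y => f y *: h y) =
  (fun p : R * W => bi p.1 p.2) \o (fun y => (f y, h y)) by [].
have dp : differentiable (fun y => (f y, h y)) x by exact: differentiable_pair.
have db := differentiable_bilin (f x, h x) bic.
have dfh : differentiable (fun y => f y *: h y) x.
  by rewrite E; exact: differentiable_comp.
split=> // v.
by rewrite !deriveE// E diff_comp//= diff_pair// (diff_bilin _ bic).
Qed.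

Lemma Ck_weak V W k (U : set V) (f : V -> W) : Ck k.+1 U f -> Ck k U f.
Proof.
elim: k f => [|k IH] f [df Df].
  by move=> x Ux; exact: differentiable_continuous (df x Ux).
by split=> // v; exact: IH.
Qed.

Lemma Ck_sub V W k (U U' : set V) (f : V -> W) :
  U' `<=` U -> Ck k U f -> Ck k U' f.
Proof.
move=> sU; elim: k f => [|k IH] f /=; first by move=> cf x /sU; exact: cf.
by move=> [df Df]; split=> [x /sU|v]; [exact: df|exact: IH].
Qed.

(** [Ck] is a pointwise condition whose derivatives are taken in the ambient space, so it can be
    tested on arbitrary sets [N] that cover [U]. *)
Lemma Ck_glue V W k (U : set V) (f : V -> W) :
  (forall x, U x -> exists2 N, N x & Ck k N f) -> Ck k U f.
Proof.
elim: k f => [|k IH] f H.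
  by move=> x Ux; have [N Nx cf] := H x Ux; exact: cf.
split=> [x Ux|v]; first by have [N Nx [df _]] := H x Ux; exact: df.
by apply: IH => x Ux; have [N Nx [_ Df]] := H x Ux; exists N => //; exact: Df.
Qed.

(** Openness of [U] makes the two maps agree near each of its points, hence so do their directional
    derivatives, and induction applies. *)
Lemma Ck_ext V W k (U : set V) (f g : V -> W) : open U ->
  (forall x, U x -> f x = g x) -> Ck k U f -> Ck k U g.
Proof.
move=> oU; elim: k f g => [|k IH] f g fg.
  move=> cf x Ux; have fgx : \near x, f x = g x.
    by apply: filterS (open_nbhs_nbhs (conj oU Ux)) => y /fg.
  rewrite /prop_for /continuous_at -(fg x Ux).
  apply: cvg_trans (cf x Ux); exact: near_eq_cvg.
move=> [df Df].
have fgx x : U x -> \near x, f x = g x.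
  by move=> Ux; apply: filterS (open_nbhs_nbhs (conj oU Ux)) => y /fg.
split=> [x Ux|v]; first exact: near_eq_differentiable (fgx x Ux) (df x Ux).
by apply: IH (Df v) => x Ux; exact: near_eq_derive (fgx x Ux).
Qed.

Lemma Ck_cst V W k (U : set V) (a : W) : Ck k U (fun=> a).
Proof.
elim: k a => [|k IH] a /=; first by move=> x _; exact: cvg_cst.
split=> [x _|v]; first exact: differentiable_cst.
by have -> : 'D_v (fun _ : V => a) = fun=> 0
  by apply/funext => x; exact: derive_cst.
Qed.

Lemma CkD V W k (U : set V) (f g : V -> W) : open U ->
  Ck k U f -> Ck k U g -> Ck k U (fun x => f x + g x).
Proof.
move=> oU; elim: k f g => [|k IH] f g.
  by move=> cf cg x Ux; apply: cvgD; [exact: cf|exact: cg].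
move=> [df Df] [dg Dg]; split=> [x Ux|v].
  by apply: differentiableD; [exact: df|exact: dg].
apply: Ck_ext oU _ (IH _ _ (Df v) (Dg v)) => x Ux.
by rewrite -deriveD//; apply: diff_derivable; [exact: df|exact: dg].
Qed.

Lemma CkZ V W k (U : set V) (f : V -> R) (g : V -> W) : open U ->
  Ck k U f -> Ck k U g -> Ck k U (fun x => f x *: g x).
Proof.
move=> oU; elim: k f g => [|k IH] f g.
  by move=> cf cg x Ux; apply: cvgZ; [exact: cf|exact: cg].
move=> Cf Cg; have [[df Df] [dg Dg]] := (Cf, Cg); split=> [x Ux|v].
  by have [] := diff_scale (df x Ux) (dg x Ux).
(* Each term of the product rule keeps one factor undifferentiated; [Ck_weak] lowers its class to
   the one in the induction hypothesis. *)
apply: (Ck_ext oU _ (CkD oU (IH _ _ (Ck_weak Cf) (Dg v))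
                            (IH _ _ (Df v) (Ck_weak Cg)))) => x Ux.
by have [_ ->] := diff_scale (df x Ux) (dg x Ux).
Qed.

Lemma Ck_linear V W W' k (U : set V) (l : {linear W -> W'}) (f : V -> W) :
  continuous l -> open U -> Ck k U f -> Ck k U (l \o f).
Proof.
move=> cl oU; have dl y : differentiable l y by exact: linear_differentiable.
elim: k f => [|k IH] f.
  by move=> cf x Ux; apply: continuous_comp; [exact: cf|exact: cl].
move=> [df Df]; split=> [x Ux|v].
  by apply: differentiable_comp => //; exact: df.
apply: (Ck_ext oU _ (IH _ (Df v))) => x Ux /=.
have dfx := df x Ux.
have dlf : differentiable (l \o f) x by exact: differentiable_comp.
rewrite (deriveE v dlf) (deriveE v dfx).
by rewrite (diff_comp dfx (dl _)) /= (diff_lin _ cl).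
Qed.

(** Smoothness of [p] is encoded by membership in a family [S] closed under derivation: the chain
    rule turns [p \o f] into [q \o f] times a derivative of [f], with [q] again in [S]. *)
Lemma Ck_comp_real V k (U : set V) (S : set (R -> R)) (p : R -> R)
    (f : V -> R) :
  (forall p, S p -> exists2 q, S q & forall t : R, is_derive t 1 p (q t)) ->
  S p -> open U -> Ck k U f -> Ck k U (p \o f).
Proof.
move=> HS + oU; elim: k p f => [|k IH] p f Sp.
  have [q Sq dq] := HS p Sp.
  move=> cf x Ux; apply: continuous_comp; first exact: cf.
  by apply: differentiable_continuous; apply/derivable1_diffP; have [] := dq (f x).
move=> Cf; have [df Df] := Cf; have [q Sq dq] := HS p Sp.
have dp t : differentiable p t by apply/derivable1_diffP; have [] := dq t.
split=> [x Ux|v]; first by apply: differentiable_comp => //; exact: df.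
apply: (Ck_ext oU _ (CkZ oU (IH q f Sq (Ck_weak Cf)) (Df v))) => x Ux /=.
have dfx := df x Ux.
have dpf : differentiable (p \o f) x by exact: differentiable_comp.
rewrite (deriveE v dpf) (deriveE v dfx) (diff_comp dfx (dp _)) /=.
(* A linear map on the line is multiplication by its value at 1, here the derivative of [p]. *)
set w := 'd f x v; rewrite -[in RHS](mulr1 w) [in RHS]linearZ/= -deriveE//.
by have [_ ->] := dq (f x); exact: mulrC.
Qed.

End CkTheory.

(** * A smooth step function *)

Section FlatExponential.
Context {R : realType}.

(* For t > 0 this is p(1/t) exp(-1/t); with p ranging over all polynomials, the
   family is closed under differentiation. *)
Definition flat_exp (p : {poly R}) (t : R) : R :=
  if 0 < t then p.[t^-1] * expR (- t^-1) else 0.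

Lemma horner_bound (p : {poly R}) :
  exists2 c, 0 <= c & forall s : R, 1 <= s -> `|p.[s]| <= c * s ^+ size p.
Proof.
elim/poly_ind: p => [|p a [c c0 IH]].
  by exists 0 => // s _; rewrite horner0 normr0 mul0r.
exists (c + `|a|) => [|s s1]; first by rewrite addr_ge0.
have s0 : 0 <= s by exact: le_trans s1.
(* The size of [p * 'X + a%:P] exceeds that of [p] by one, except when [p] and [a] both vanish. *)
have [/eqP p0|pn0] := boolP (p == 0).
  rewrite p0 mul0r add0r hornerC (le_trans (y := `|a| * s ^+ size a%:P))//.
    by rewrite ler_peMr// exprn_ege1.
  by rewrite ler_wpM2r ?exprn_ge0// lerDr.
rewrite size_MXaddC (negbTE pn0)/= hornerMXaddC exprS.
have sp1 : 1 <= s ^+ size p by exact: exprn_ege1.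
apply: (le_trans (ler_normD _ _)); rewrite normrM (ger0_norm s0).
rewrite mulrDl lerD//.
  by rewrite mulrCA mulrC ler_wpM2l// IH.
by rewrite ler_peMr// -[1]mulr1 ler_pM.
Qed.

(** With s = 1/t, the polynomial is at most a multiple of s^(size p), while exp(s) dominates s^(size
    p + 2) up to a factorial; the quotient leaves s^(-2) = t^2. A quadratic bound is what
    differentiability at 0 requires. *)
Lemma flat_exp_bound (p : {poly R}) :
  exists2 c, 0 < c & forall t : R, `|t| <= 1 -> `|flat_exp p t| <= c * t ^+ 2.
Proof.
have [c c0 H] := horner_bound p.
pose m := (size p).+1; have m0 : 0 < m.+1`!%:R :> R by rewrite ltr0n fact_gt0.
(* The summand 1 only makes the constant positive, since [c] may be 0. *)
exists (c * m.+1`!%:R + 1) => [|t t1].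
  by rewrite ltr_wpDl// mulr_ge0// ltW.
have d0 : 0 <= c * m.+1`!%:R + 1 by rewrite addr_ge0// mulr_ge0// ltW.
rewrite /flat_exp; case: ifPn => [t0|_]; last first.
  by rewrite normr0 mulr_ge0// sqr_ge0.
have s0 : 0 < t^-1 by rewrite invr_gt0.
have s1 : 1 <= t^-1 by rewrite invf_ge1// (le_trans (ler_norm t)).
set s := t^-1 in s0 s1 *.
have -> : t = s^-1 by rewrite invrK.
rewrite normrM [`|expR _|]ger0_norm ?expR_ge0// expRN.
rewrite ler_pdivrMr ?expR_gt0//.
apply: (le_trans (H s s1)).
have He : s ^+ m.+1 <= m.+1`!%:R * expR s.
  rewrite mulrC -ler_pdivrMr// (le_trans _ (expR_ge1Dxn m (ltW s0)))//.
  by rewrite lerDr.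
have -> : s ^+ size p = s ^+ m.+1 * s^-1 ^+ 2.
  rewrite /m -addn2 exprD exprVn mulfK// expf_neq0// gt_eqF//.
rewrite mulrA [leRHS]mulrAC ler_wpM2r ?sqr_ge0//.
rewrite (le_trans (y := c * (m.+1`!%:R * expR s)))//.
  by rewrite ler_wpM2l.
by rewrite mulrA mulrDl lerDl mul1r expR_ge0.
Qed.

(** For t > 0, differentiating p(1/t) exp(-1/t) brings out the factor 1/t^2 and replaces p by p -
    p'. For t < 0 the function is locally zero. *)
Lemma is_derive_flat_exp (p : {poly R}) (t : R) :
  is_derive t 1 (flat_exp p) (flat_exp ('X^2 * (p - p^`())) t).
Proof.
have [t0|t0|->] := ltgtP t 0.
- rewrite {2}/flat_exp ltNge (ltW t0)/=.
  apply: (near_eq_is_derive (f := cst 0)) => //.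
  near=> y; rewrite /flat_exp ifF//; apply/negbTE; rewrite -leNgt ltW//.
  near: y; exact: lt_nbhsl.
- rewrite {2}/flat_exp t0.
  pose i := fun s : R => s^-1.
  have di : is_derive t 1 i (- t ^- 2 *: 1).
    by apply: (@is_deriveV _ id t 1 1); rewrite gt_eqF.
  apply: (near_eq_is_derive
    (f := (horner p \o i) * (expR \o (fun s => - i s)))).
    near=> y; rewrite /flat_exp ifT//.
    near: y; exact: lt_nbhsr.
  have dn : is_derive t 1 (fun s => - i s) (- (- t ^- 2 *: 1)) by exact: is_deriveN.
  apply: is_derive_eq.
  rewrite /i/= !hornerE/= /GRing.scale/= expr2; field.
  by rewrite gt_eqF.
(* At 0 the difference quotient is at most c|h| by the quadratic bound, so the derivative is 0. *)
have [c c0 H] := flat_exp_bound p.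
have f0 q : flat_exp q 0 = 0 by rewrite /flat_exp ltxx.
rewrite f0.
have cv : h^-1 *: (flat_exp p (h *: 1 + 0) - flat_exp p 0) @[h --> 0^'] --> (0 : R).
  apply/cvgr0Pnorm_le => e e0.
  near=> h.
  rewrite f0 subr0 addr0 [h *: 1]mulr1 normrM normfV.
  have h0 : h != 0 by near: h; exact: nbhs_dnbhs_neq.
  rewrite ler_pdivrMl ?normr_gt0//.
  have h1 : `|h| <= 1 by near: h; apply: dnbhs0_le.
  have h2 : `|h| <= e / c by near: h; apply: dnbhs0_le; rewrite divr_gt0.
  rewrite (le_trans (H h h1))// -(real_normK (num_real h)) expr2 mulrCA ler_wpM2l//.
  by rewrite mulrC -ler_pdivlMr.
by apply: DeriveDef; [apply/cvg_ex; exists 0|exact/cvg_lim].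
Unshelve. all: by end_near. Qed.

Lemma Ck_flat_exp (V : normedModType R) k (U : set V) (f : V -> R) :
  open U -> Ck k U f -> Ck k U (flat_exp 1 \o f).
Proof.
apply: (@Ck_comp_real _ _ _ _ (range flat_exp)); last by exists 1.
move=> _ [p _ <-]; exists (flat_exp ('X^2 * (p - p^`()))); first by eexists.
exact: is_derive_flat_exp.
Qed.

Lemma flat_exp1E (t : R) : 0 < t -> flat_exp 1 t = expR (- t^-1).
Proof. by move=> t0; rewrite /flat_exp t0 hornerC mul1r. Qed.

(* With f = flat_exp 1, the value f 1 - f t is the constant f 1 for t <= 0 and is
   nonpositive, hence killed by f, for t >= 1. *)
Definition smooth_step (t : R) : R :=
  flat_exp 1 (flat_exp 1 1 - flat_exp 1 t) / flat_exp 1 (flat_exp 1 1).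

Lemma smooth_step1 (t : R) : t <= 0 -> smooth_step t = 1.
Proof.
move=> t0; rewrite /smooth_step [flat_exp 1 t]/flat_exp ltNge t0/= subr0.
by rewrite divff// !flat_exp1E ?expR_gt0// gt_eqF// expR_gt0.
Qed.

Lemma smooth_step0 (t : R) : 1 <= t -> smooth_step t = 0.
Proof.
move=> t1; rewrite /smooth_step [X in X / _]/flat_exp ifF ?mul0r//.
apply/negbTE; rewrite -leNgt subr_le0 !flat_exp1E ?(lt_le_trans ltr01)//.
by rewrite ler_expR lerN2 invr1 invf_le1// (lt_le_trans ltr01).
Qed.

Lemma Ck_smooth_step (V : normedModType R) k (U : set V) (f : V -> R) :
  open U -> Ck k U f -> Ck k U (smooth_step \o f).
Proof.
move=> oU Cf.
have C1 : Ck k U (fun x => flat_exp 1 1 + (-1) *: (flat_exp 1 \o f) x).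
  apply: CkD => //; first exact: Ck_cst.
  by apply: CkZ => //; [exact: Ck_cst|exact: Ck_flat_exp].
apply: (Ck_ext oU _ (CkZ oU (Ck_cst k U (flat_exp 1 (flat_exp 1 1))^-1)
  (Ck_flat_exp oU C1))) => x _ /=.
by rewrite scaleN1r [LHS]mulrC.
Qed.

End FlatExponential.

(** * Smooth functions on manifolds *)

Section SmoothFunctions.
Context {R : realType} {n : nat} {M : smooth_manifold R n}.
Implicit Types W : normedModType R.

(** Near [cmap c x] the image contains the part of the open chart image that the continuous map
    [cinv c] sends into [U]. *)
Lemma chart_image_open (c : chart (R := R) M n) (U : set M) :
  open U -> open (cmap c @` (cdom c `&` U)).
Proof.
move=> oU; rewrite openE => y [x [cx Ux] <-{y}].
have ix : (cmap c @` cdom c) (cmap c x) by exists x.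
have cU : nbhs (cinv c (cmap c x)) U.
  by rewrite cmapK//; exact: open_nbhs_nbhs.
have := cinv_continuous ix cU.
have := open_nbhs_nbhs (conj (@cimg_open _ _ _ c) ix).
apply: filterS2 => y [z cz <-]; rewrite /= cmapK// => Uz.
by exists z.
Qed.

Lemma smooth_on_ext W (U : set M) (f g : M -> W) : open U ->
  (forall x, U x -> f x = g x) -> smooth_on U f -> smooth_on U g.
Proof.
move=> oU fg Sf c Ac k; apply: Ck_ext (Sf c Ac k); first exact: chart_image_open.
by move=> y [x [cx Ux] <-] /=; rewrite cmapK// fg.
Qed.

Lemma smooth_on_sub W (U U' : set M) (f : M -> W) :
  U' `<=` U -> smooth_on U f -> smooth_on U' f.
Proof.
move=> sU Sf c Ac k; apply: Ck_sub (Sf c Ac k).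
by move=> y [x [cx Ux] <-]; exists x => //; split => //; exact: sU.
Qed.

Lemma smooth_on_local W (U : set M) (f : M -> W) :
  (forall x, U x -> exists2 N, N x & smooth_on N f) -> smooth_on U f.
Proof.
move=> H c Ac k; apply: Ck_glue => y [x [cx Ux] <-].
have [N Nx Sf] := H x Ux.
by exists (cmap c @` (cdom c `&` N)); [exists x|exact: Sf].
Qed.

Lemma smooth_on_cst W (U : set M) (a : W) : smooth_on U (fun=> a).
Proof. by move=> c Ac k; exact: Ck_cst. Qed.

Lemma smooth_onD W (U : set M) (f g : M -> W) : open U ->
  smooth_on U f -> smooth_on U g -> smooth_on U (fun x => f x + g x).
Proof.
move=> oU Sf Sg c Ac k.
by apply: (CkD (chart_image_open oU) (Sf c Ac k) (Sg c Ac k)).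
Qed.

Lemma smooth_onZ W (U : set M) (f : M -> R) (g : M -> W) : open U ->
  smooth_on U f -> smooth_on U g -> smooth_on U (fun x => f x *: g x).
Proof.
move=> oU Sf Sg c Ac k.
by apply: (CkZ (chart_image_open oU) (Sf c Ac k) (Sg c Ac k)).
Qed.

Lemma smooth_on_sum W (I : Type) (s : seq I) (U : set M) (f : I -> M -> W) :
  open U -> (forall i, smooth_on U (f i)) ->
  smooth_on U (fun x => \sum_(i <- s) f i x).
Proof.
move=> oU Sf; elim: s => [|i s IH].
  apply: (smooth_on_ext oU _ (smooth_on_cst U (0 : W))) => x _.
  by rewrite big_nil.
apply: (smooth_on_ext oU _ (smooth_onD oU (Sf i) IH)) => x _.
by rewrite big_cons.
Qed.

(** * Coordinates and bump functions *)

Definition coord r (i : 'I_r) (v : 'rV[R]_r) : R := v 0 i.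

Lemma coord_is_linear r (i : 'I_r) : linear (coord i : 'rV[R]_r -> R).
Proof. by move=> a v w; rewrite /coord !mxE. Qed.

HB.instance Definition _ r (i : 'I_r) :=
  GRing.isLinear.Build R 'rV[R]_r R _ (coord i) (coord_is_linear i).

Lemma Ck_coord (V : normedModType R) k r (i : 'I_r) (U : set V)
    (f : V -> 'rV[R]_r) :
  open U -> Ck k U f -> Ck k U (fun x => f x 0 i).
Proof.
move=> oU Cf; apply: (Ck_linear (l := coord i)) Cf => //.
exact: coord_continuous.
Qed.

Lemma smooth_on_coord r (i : 'I_r) (U : set M) (f : M -> 'rV[R]_r) : open U ->
  smooth_on U f -> smooth_on U (fun x => f x 0 i).
Proof.
move=> oU Sf c Ac k; exact: Ck_coord (chart_image_open oU) (Sf c Ac k).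
Qed.

(** The squared Euclidean distance is polynomial in the coordinates, hence smooth, whereas the norm
    of row vectors is the sup norm. *)
Definition sqdist r (a v : 'rV[R]_r) : R := \sum_i (v 0 i - a 0 i) ^+ 2.

Lemma Ck_sqdist (V : normedModType R) k r (a : 'rV[R]_r) (U : set V)
    (f : V -> 'rV[R]_r) :
  open U -> Ck k U f -> Ck k U (sqdist a \o f).
Proof.
move=> oU Cf; rewrite /sqdist.
suff H s : Ck k U (fun x => \sum_(i <- s) (f x 0 i - a 0 i) ^+ 2) by exact: H.
elim: s => [|i s IH].
  apply: (Ck_ext oU _ (Ck_cst k U (0 : R))) => x _.
  by rewrite big_nil.
have Ci : Ck k U (fun x => f x 0 i - a 0 i).
  by apply: CkD => //; [exact: Ck_coord|exact: Ck_cst].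
apply: (Ck_ext oU _ (CkD oU (CkZ oU Ci Ci) IH)) => x _.
by rewrite big_cons expr2.
Qed.

(** A smooth step of the squared distance to [x] in a chart, extended by zero. The closed set [C]
    records that the support stays inside [U], which is what makes later extensions by zero
    smooth. *)
Lemma bump_function (x : M) (U : set M) :
  hausdorff_space M -> open U -> U x ->
  exists phi : M -> R, [/\ smooth_fun phi, \forall y \near x, phi y = 1 &
    exists C : set M, [/\ closed C, C `<=` U & forall y, ~ C y -> phi y = 0]].
Proof.
move=> hM oU Ux; have [c Ac cx] := matlas_cover x.
set a := cmap c x.
have /nbhs_ballP[e' /= e'0 He'] : nbhs a (cmap c @` (cdom c `&` U)).
  by apply: open_nbhs_nbhs; split; [exact: chart_image_open|exists x].
(* Halving the radius puts the closed Euclidean ball [K] of radius [e] inside the open sup-norm ball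
   of radius [e']. *)
pose e := e' / 2; have e0 : 0 < e by rewrite divr_gt0.
have ee' : e < e' by rewrite /e; lra.
pose K := [set y : 'rV[R]_n | sqdist a y <= e ^+ 2].
have Kball : K `<=` ball a e'.
  move=> y Ky; split=> // i j; rewrite ord1 /ball/= distrC (le_lt_trans _ ee')//.
  rewrite -(ler_pXn2r (n := 2))// ?nnegrE ?(ltW e0)// real_normK ?num_real//.
  apply: le_trans Ky; rewrite /sqdist (bigD1 j)//= lerDl sumr_ge0// => k _.
  exact: sqr_ge0.
have Kimg : K `<=` cmap c @` (cdom c `&` U) by move=> y /Kball /He'.
have qc : continuous (sqdist a : 'rV[R]_n -> R).
  move=> y; apply: (Ck_sqdist (k := 0) a openT (f := id)) => //= z _; exact: cvg_id.
have Kcl : closed K by apply: (preimage_closed _ (@closed_le R (e ^+ 2))) => y _; exact: qc.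
have Kco : compact K.
  apply: bounded_closed_compact => //.
  exists (`|a| + e'); split; first exact: num_real.
  move=> N ltN y /Kball; rewrite -ball_normE /= => ay; apply: ltW; apply: le_lt_trans ltN.
  rewrite -[y](subrK a) addrC (le_trans (ler_normD _ _))// lerD2l distrC.
  exact: ltW.
pose C := cinv c @` K.
(* The Hausdorff property enters here: [C] is a continuous image of a compact set, hence closed in
   the whole of [M] and not only in the chart. *)
have Ccl : closed C.
  apply: compact_closed => //; apply: continuous_compact => //.
  apply: continuous_in_subspaceT => y; rewrite inE => /Kimg[z [cz _] <-].
  by apply: cinv_continuous; exists z.
have CU : C `<=` cdom c `&` U.
  by move=> y [z /Kimg[w [cw Uw] <-] <-]; rewrite cmapK.
(* With this [d], the step is 1 where the squared distance is at most [d], and 0 where it is at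
   least 2d = e^2, in particular off [K]. *)
pose d := e ^+ 2 / 2; have d0 : 0 < d by rewrite divr_gt0// exprn_gt0.
pose psi y := smooth_step (d^-1 *: sqdist a (cmap c y) + (-1)).
pose phi y := if pselect (cdom c y) then psi y else 0.
have phi0 y : ~ C y -> phi y = 0.
  rewrite /phi; case: pselect => //= cy Cy; apply: smooth_step0.
  have : ~ K (cmap c y) by move=> Ky; apply: Cy; exists (cmap c y) => //; rewrite cmapK.
  move=> /negP; rewrite -ltNge => /ltW Ke.
  rewrite lerBrDr -[X in _ <= X]/(_ * _) mulrC ler_pdivlMr//.
  by apply: le_trans Ke; rewrite /d; lra.
exists phi; split.
- apply: smooth_on_local => y _.
  (* A point outside the chart lies in the open complement of [C], where [phi] vanishes; inside the
     chart [phi] is [psi]. *)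
  have [cy|ncy] := pselect (cdom c y); last first.
    exists (~` C); first by move=> /CU[].
    apply: (smooth_on_ext (closed_openC Ccl) _ (smooth_on_cst _ 0)) => z.
    by move=> /phi0.
  exists (cdom c) => //.
  apply: (smooth_on_ext (f := psi)); first exact: cdom_open.
    by move=> z cz; rewrite /phi; case: pselect.
  move=> b Ab k.
  (* Read in another chart [b], [psi] is the step applied to the squared distance of the transition
     map from [b] to [c]. *)
  have ob := @chart_image_open b _ (@cdom_open _ _ _ c).
  have Cs := Ck_sqdist a ob (matlas_compat Ab Ac k).
  have Ca : Ck k (cmap b @` (cdom b `&` cdom c))
      (fun z => d^-1 *: (sqdist a \o (cmap c \o cinv b)) z + (-1)).
    apply: CkD => //; last exact: Ck_cst.
    by apply: CkZ => //; exact: Ck_cst.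
  exact: Ck_smooth_step ob Ca.
- have sa : sqdist a (cmap c x) = 0.
    by rewrite /sqdist big1// => i _; rewrite subrr expr0n.
  have := open_nbhs_nbhs (conj (@cdom_open _ _ _ c) cx).
  have : \forall y \near x, sqdist a (cmap c y) < d.
    have cc : {for x, continuous (sqdist a \o cmap c)}.
      by apply: continuous_comp; [exact: cmap_continuous|exact: qc].
    by apply: (cc [set t | t < d]); rewrite /= sa; exact: lt_nbhsl.
  apply: filterS2 => y yd cy; rewrite /phi; case: pselect => //= _.
  apply: smooth_step1; rewrite lerBlDr add0r -[X in X <= _]/(_ * _) mulrC.
  by rewrite ler_pdivrMr// mul1r ltW.
- by exists C; split=> // y /CU[].
Qed.

End SmoothFunctions.

(** * Sections and forms of vector bundles *)

Section Cutoff.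
Context {R : realType} {n : nat} {M : smooth_manifold R n}.

Definition supported_in (U : set M) (phi : M -> R) : Prop :=
  exists C : set M, [/\ closed C, C `<=` U & forall y, ~ C y -> phi y = 0].

(** Points of [V] outside [U] lie in the open complement of the closed set carrying [phi], where the
    product is zero whatever [f] is. *)
Lemma smooth_on_cutoff (W : normedModType R) (U V : set M) (phi : M -> R)
    (f : M -> W) :
  open U -> open V -> smooth_fun phi -> supported_in U phi ->
  smooth_on (V `&` U) f -> smooth_on V (fun x => phi x *: f x).
Proof.
move=> oU oV Sphi [C [Ccl CU phi0]] Sf; apply: smooth_on_local => x Vx.
have [Ux|nUx] := pselect (U x).
  exists (V `&` U) => //; apply: smooth_onZ => //; first exact: openI.
  exact: smooth_on_sub Sphi.
exists (~` C); first by move=> /CU.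
apply: (smooth_on_ext (closed_openC Ccl) _ (smooth_on_cst _ 0)) => y /phi0 ->.
by rewrite scale0r.
Qed.

End Cutoff.

Lemma scalar_comb (R : realType) (V : lmodType R) (l : V -> R) (I : Type)
    (s : seq I) (c : I -> R) (F : I -> V) : scalar l ->
  l (\sum_(i <- s) c i *: F i) = \sum_(i <- s) c i * l (F i).
Proof.
move=> ll; elim: s => [|i s IH]; last by rewrite !big_cons ll IH.
by rewrite !big_nil; have := ll (-1) 0 0; rewrite scaler0 addr0 mulN1r addNr.
Qed.

Section Bundle.
Context {R : realType} {n r : nat} {M : smooth_manifold R n}.
Context {E : vector_bundle M r}.
Implicit Types (u v s : section E) (w : Defs.form E) (t : local_triv E r).

Lemma tmapP t x a (u v : E x) : tdom t x ->
  tmap t (a *: u + v) = a *: tmap t u + tmap t v.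
Proof. by move=> tx; exact: (tmap_linear tx). Qed.

Lemma tmap0 t x : tdom t x -> tmap t (0 : E x) = 0.
Proof.
by move=> tx; have := tmapP (-1) (0 : E x) 0 tx; rewrite scaler0 addr0 scaleN1r addNr.
Qed.

Lemma tmapZ t x a (u : E x) : tdom t x -> tmap t (a *: u) = a *: tmap t u.
Proof. by move=> tx; rewrite -[a *: u]addr0 tmapP// tmap0// addr0. Qed.

Lemma tmap_sum t x (I : Type) (l : seq I) (F : I -> E x) : tdom t x ->
  tmap t (\sum_(i <- l) F i) = \sum_(i <- l) tmap t (F i).
Proof.
move=> tx; elim: l => [|i l IH]; first by rewrite !big_nil tmap0.
by rewrite !big_cons -[F i]scale1r tmapP// IH !scale1r.
Qed.

(** Expansion in the frame that a trivialization induces, checked after applying the injective map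
    [tmap t]. *)
Lemma tinv_decomp t x (e : E x) : tdom t x ->
  e = \sum_i tmap t e 0 i *: tinv t x (delta_mx 0 i).
Proof.
move=> tx; apply: (can_inj (tmapK tx)); rewrite tmap_sum//.
rewrite [LHS]row_sum_delta; apply: eq_bigr => i _.
by rewrite tmapZ// (tinvK tx).
Qed.

Lemma smooth_section_on_ext (U : set M) u v : open U ->
  (forall x, U x -> u x = v x) -> smooth_section_on U u -> smooth_section_on U v.
Proof.
move=> oU uv Su t At; apply: smooth_on_ext (Su t At).
  by apply: openI => //; exact: tdom_open.
by move=> x [_ Ux]; rewrite uv.
Qed.

(** Serves for the projected bracket, which is only known to agree near each point with some global
    smooth section. *)
Lemma smooth_section_local u :
  (forall x : M, exists2 v, smooth_section v & \forall y \near x, v y = u y) ->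
  smooth_section u.
Proof.
move=> H t At; apply: smooth_on_local => x [tx _].
have [v Sv vu] := H x.
exists (tdom t `&` interior [set y | v y = u y]) => //.
apply: (smooth_on_ext (f := fun x => tmap t (v x))).
- by apply: openI; [exact: tdom_open|exact: open_interior].
- by move=> y [_ /interior_subset ->].
- by apply: smooth_on_sub (Sv t At) => y [].
Qed.

Lemma smooth_section_on0 (U : set M) : smooth_section_on U (fun x => 0 : E x).
Proof.
move=> t At; apply: (@smooth_on_sub _ _ _ _ (tdom t)); first by move=> x [].
apply: (smooth_on_ext (@tdom_open _ _ _ _ _ t) _ (smooth_on_cst _ 0)) => x tx.
by rewrite tmap0.
Qed.

Lemma smooth_section_on_combine (U : set M) f u v : open U -> smooth_on U f ->
  smooth_section_on U u -> smooth_section_on U v ->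
  smooth_section_on U (combine f u v).
Proof.
move=> oU Sf Su Sv t At.
have oV : open (tdom t `&` U) by apply: openI => //; exact: tdom_open.
have Sf' : smooth_on (tdom t `&` U) f by apply: smooth_on_sub Sf => x [].
apply: (smooth_on_ext oV _ (smooth_onD oV (smooth_onZ oV Sf' (Su t At)) (Sv t At))).
by move=> x [tx _]; rewrite /combine tmapP.
Qed.

Lemma smooth_section_combine f u v : smooth_fun f ->
  smooth_section u -> smooth_section v -> smooth_section (combine f u v).
Proof. by move=> *; apply: smooth_section_on_combine => //; exact: openT. Qed.

Lemma smooth_section_sum (I : Type) (l : seq I) (f : I -> M -> R)
    (Y : I -> section E) :
  (forall i, smooth_fun (f i)) -> (forall i, smooth_section (Y i)) ->
  smooth_section (fun x => \sum_(i <- l) f i x *: Y i x).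
Proof.
move=> Sf SY; elim: l => [|i l IH].
  apply: (smooth_section_on_ext openT _ (smooth_section_on0 _)) => x _.
  by rewrite big_nil.
apply: (smooth_section_on_ext openT _ (smooth_section_combine (Sf i) (SY i) IH)).
by move=> x _; rewrite /combine big_cons.
Qed.

Lemma smooth_section_cutoff (U : set M) phi u : open U ->
  smooth_fun phi -> supported_in U phi -> smooth_section_on U u ->
  smooth_section (fun x => phi x *: u x).
Proof.
move=> oU Sphi phiU Su t At; rewrite setIT; have ot := @tdom_open _ _ _ _ _ t.
apply: (smooth_on_ext ot _ (smooth_on_cutoff oU ot Sphi phiU (Su t At))).
by move=> x tx; rewrite tmapZ.
Qed.

Lemma smooth_tinv t (a : 'rV[R]_r) : trivs t ->
  smooth_section_on (tdom t) (fun x => tinv t x a : E x).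
Proof. by move=> At b Ab; rewrite setIC; exact: trivs_compat. Qed.

Lemma smooth_form_combine f w w' : smooth_fun f ->
  smooth_form w -> smooth_form w' -> smooth_form (combine_form f w w').
Proof.
move=> Sf [lw Sw] [lw' Sw']; split=> [x _ a e e'|t At a].
  by rewrite /combine_form lw// lw'//= /GRing.scale/=; ring.
have ot : open (tdom t `&` setT) by rewrite setIT; exact: tdom_open.
have Sf' : smooth_on (tdom t `&` setT) f by apply: smooth_on_sub Sf.
exact: (smooth_onD ot (smooth_onZ ot Sf' (Sw t At a)) (Sw' t At a)).
Qed.

Lemma smooth_form_on_ext (U : set M) w w' : open U ->
  (forall x, U x -> w x = w' x) -> smooth_form_on U w -> smooth_form_on U w'.
Proof.
move=> oU ww' [lw Sw]; split=> [x Ux|t At a]; first by rewrite -ww'//; exact: lw.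
apply: smooth_on_ext (Sw t At a).
  by apply: openI => //; exact: tdom_open.
by move=> x [_ Ux]; rewrite ww'.
Qed.

Lemma smooth_form0 : smooth_form (fun x (e : E x) => 0).
Proof.
split=> [x _ a e e'|t At a]; first by rewrite mulr0 addr0.
exact: smooth_on_cst.
Qed.

Lemma smooth_form_sum (I : Type) (l : seq I) (f : I -> M -> R)
    (h : I -> Defs.form E) :
  (forall i, smooth_fun (f i)) -> (forall i, smooth_form (h i)) ->
  smooth_form (fun x e => \sum_(i <- l) f i x * h i x e).
Proof.
move=> Sf Sh; elim: l => [|i l IH].
  apply: (smooth_form_on_ext openT _ smooth_form0) => x _.
  by apply/funext => e; rewrite big_nil.
apply: (smooth_form_on_ext openT _ (smooth_form_combine (Sf i) (Sh i) IH)).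
by move=> x _; apply/funext => e; rewrite /combine_form big_cons.
Qed.

Lemma smooth_form_cutoff (U : set M) phi w : open U ->
  smooth_fun phi -> supported_in U phi -> smooth_form_on U w ->
  smooth_form (fun x e => phi x * w x e).
Proof.
move=> oU Sphi phiU [lw Sw]; split=> [x _ a e e'|t At a].
  have [Ux|nUx] := pselect (U x).
    by rewrite lw//= /GRing.scale/=; ring.
  (* Outside [U] nothing is known of [w], but there [phi] vanishes. *)
  have [C [_ CU ->]] := phiU; last by move=> /CU.
  by rewrite !mul0r mulr0 addr0.
rewrite setIT; have ot := @tdom_open _ _ _ _ _ t.
exact: (smooth_on_cutoff oU ot Sphi phiU (Sw t At a)).
Qed.

Lemma smooth_coord_form t (i : 'I_r) : trivs t ->
  smooth_form_on (tdom t) (fun x (e : E x) => tmap t e 0 i).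
Proof.
move=> At; split=> [x tx a e e'|b Ab a]; first by rewrite tmapP// !mxE.
apply: smooth_on_coord; last by exact: trivs_compat.
by apply: openI; exact: tdom_open.
Qed.

(** * Global extensions of local sections, forms and frames *)

Hypothesis hM : hausdorff_space M.

(** Cutting [s] off with a bump function at [x] gives a global section with the same germ, so the
    choice in [extend] never falls back on its default. *)
Lemma extendP (U : set M) x s : open U -> U x -> smooth_section_on U s ->
  smooth_section (extend x s) /\ \forall y \near x, extend x s y = s y.
Proof.
move=> oU Ux Ss; rewrite /extend /pick_or; case: pselect => [h|[]].
  by case: (cid h).
have [phi [Sphi phi1 phiU]] := bump_function hM oU Ux.
exists (fun y => phi y *: s y); split; first exact: smooth_section_cutoff phiU Ss.
by apply: filterS phi1 => y ->; rewrite scale1r.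
Qed.

Lemma extend_formP (U : set M) x w : open U -> U x -> smooth_form_on U w ->
  smooth_form (extend_form x w) /\ \forall y \near x, @extend_form _ _ _ _ E x w y = w y.
Proof.
move=> oU Ux Sw; rewrite /extend_form /pick_or; case: pselect => [h|[]].
  by case: (cid h).
have [phi [Sphi phi1 phiU]] := bump_function hM oU Ux.
exists (fun y e => phi y * w y e); split; first exact: smooth_form_cutoff phiU Sw.
by apply: filterS phi1 => y ->; apply/funext => e; rewrite mul1r.
Qed.

Lemma framingP x : exists U : set M,
  [/\ U x, local_frame U (framing (E := E) x).1 &
      dual_coframe U (framing (E := E) x).1 (framing x).2].
Proof.
rewrite /framing /pick_or; case: pselect => [h|[]]; first by case: (cid h).
have [t At tx] := trivs_cover E x.
(* The standard basis carried over by a trivialization, with the coordinate forms as its dual. *)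
exists (fun a y => tinv t y (delta_mx 0 a), fun a y e => tmap t e 0 a).
exists (tdom t); split=> //=.
  split=> [|a|y ty e]; [exact: tdom_open|exact: smooth_tinv|].
  exists (fun a => tmap t e 0 a); split; first exact: tinv_decomp.
  move=> c ->; apply/funext => a; rewrite tmap_sum// summxE (bigD1 a)//=.
  rewrite big1 ?addr0 => [|b ba]; rewrite tmapZ// (tinvK ty) !mxE/= ?eqxx ?mulr1//.
  by rewrite eq_sym (negbTE ba) mulr0.
move=> a; split; first exact: smooth_coord_form.
by move=> y ty b; rewrite (tinvK ty) !mxE/=.
Qed.

(** * Tensoriality: values of linear operators at a point *)

Lemma Cinf_linear0 (T : endo_op E) : Cinf_linear T ->
  T (fun x => 0) = fun x => 0.
Proof.
move=> [_ TZ]; have S0 : smooth_section (fun x => 0 : E x).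
  exact: smooth_section_on0.
have S1 : smooth_fun (fun _ : M => -1 : R) by exact: smooth_on_cst.
have /(congr1 (fun s : section E => s _)) E0 := TZ _ _ _ S1 S0 S0.
apply/functional_extensionality_dep => x.
transitivity (T (combine (fun=> -1) (fun x => 0) (fun x => 0)) x).
  congr (T _ x); apply/functional_extensionality_dep => y.
  by rewrite /combine scaler0 addr0.
by rewrite E0 /combine scaleN1r addNr.
Qed.

Lemma Cinf_linear_sum (T : endo_op E) (I : Type) (l : seq I) (f : I -> M -> R)
    (Y : I -> section E) q : Cinf_linear T ->
  (forall i, smooth_fun (f i)) -> (forall i, smooth_section (Y i)) ->
  T (fun x => \sum_(i <- l) f i x *: Y i x) q = \sum_(i <- l) f i q *: T (Y i) q.
Proof.
move=> CT Sf SY; elim: l => [|i l IH].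
  rewrite big_nil -[RHS]/((fun x => 0 : E x) q) -(Cinf_linear0 CT).
  by congr (T _ q); apply/functional_extensionality_dep => x; rewrite big_nil.
rewrite big_cons -IH.
have -> : (fun x => \sum_(j <- i :: l) f j x *: Y j x) =
    combine (f i) (Y i) (fun x => \sum_(j <- l) f j x *: Y j x).
  by apply/functional_extensionality_dep => x; rewrite big_cons.
by rewrite CT.2//; exact: smooth_section_sum.
Qed.

(* With a bump function phi at q, the section phi^2 u is a combination of a
   cut-off local frame whose smooth coefficients all vanish at q. *)
Lemma Cinf_linear_eq0 (T : endo_op E) q u : Cinf_linear T ->
  smooth_section u -> u q = 0 -> T u q = 0.
Proof.
move=> CT Su uq0; have [t At tq] := trivs_cover E q.
have ot := @tdom_open _ _ _ _ _ t.
have [phi [Sphi /nbhs_singleton phi1 phit]] := bump_function hM ot tq.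
pose f i y := phi y *: tmap t (u y) 0 i.
pose Y i y := phi y *: tinv t y (delta_mx 0 i).
have Sf i : smooth_fun (f i).
  apply: (smooth_on_cutoff ot openT Sphi phit).
  rewrite setTI; apply: smooth_on_coord => //.
  by have := Su t At; rewrite setIT.
have SY i : smooth_section (Y i).
  by apply: (smooth_section_cutoff ot Sphi phit); exact: smooth_tinv.
have S2 : smooth_fun (fun y => phi y *: phi y) by apply: smooth_onZ => //; exact: openT.
have Efy : combine (fun y => phi y *: phi y) u (fun y => 0) =
    fun y => \sum_i f i y *: Y i y.
  apply/functional_extensionality_dep => y; rewrite /combine addr0.
  have [ty|nty] := pselect (tdom t y).
    rewrite [in LHS](tinv_decomp (u y) ty) scaler_sumr; apply: eq_bigr => i _.
    rewrite /f /Y !scalerA; congr (_ *: _); rewrite /GRing.scale/=; ring.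
  have p0 : phi y = 0 by have [C [_ CU ->]] := phit => // /CU.
  by rewrite p0 !scale0r big1// => i _; rewrite /f p0 !scale0r.
have S0 := @smooth_section_on0 setT.
transitivity (T (combine (fun y => phi y *: phi y) u (fun y => 0)) q).
  by rewrite CT.2// Cinf_linear0// /combine addr0 phi1 scale1r scale1r.
rewrite Efy Cinf_linear_sum// big1// => i _.
by rewrite /f uq0 tmap0// mxE scaler0 scale0r.
Qed.

(** The section [u] minus the combination with constant coefficients [c] vanishes at [q], hence so
    does its image under [T]. *)
Lemma Cinf_linear_comb (T : endo_op E) q u (c : 'I_r -> R)
    (Y : 'I_r -> section E) : Cinf_linear T -> smooth_section u ->
  (forall a, smooth_section (Y a)) -> u q = \sum_a c a *: Y a q ->
  T u q = \sum_a c a *: T (Y a) q.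
Proof.
move=> CT Su SY uq.
have Sc a : smooth_fun (fun _ : M => c a) by exact: smooth_on_cst.
pose s y := \sum_a c a *: Y a y.
have Ss : smooth_section s by exact: (smooth_section_sum _ Sc SY).
have S1 : smooth_fun (fun _ : M => -1 : R) by exact: smooth_on_cst.
have := @Cinf_linear_eq0 T q (combine (fun=> -1) s u) CT.
rewrite CT.2// /combine uq /s scaleN1r addNr.
move=> /(_ (smooth_section_combine S1 Ss Su) erefl)/eqP.
rewrite scaleN1r addrC subr_eq0 => /eqP ->.
exact: (Cinf_linear_sum _ q CT Sc SY).
Qed.

Definition form_linear (T : Defs.form E -> section E) : Prop :=
  forall f w w', smooth_fun f -> smooth_form w -> smooth_form w' ->
    T (combine_form f w w') = combine f (T w) (T w').

Lemma form_linear0 T : form_linear T -> T (fun x e => 0) = fun x => 0.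
Proof.
move=> TZ; have S0 := smooth_form0.
have S1 : smooth_fun (fun _ : M => -1 : R) by exact: smooth_on_cst.
have E0 := TZ _ _ _ S1 S0 S0.
apply/functional_extensionality_dep => x.
transitivity (T (combine_form (fun=> -1) (fun x e => 0) (fun x e => 0)) x).
  congr (T _ x); apply/functional_extensionality_dep => y; apply/funext => e.
  by rewrite /combine_form mulr0 addr0.
by rewrite E0 /combine scaleN1r addNr.
Qed.

Lemma form_linear_sum T (I : Type) (l : seq I) (f : I -> M -> R)
    (h : I -> Defs.form E) q : form_linear T ->
  (forall i, smooth_fun (f i)) -> (forall i, smooth_form (h i)) ->
  T (fun x e => \sum_(i <- l) f i x * h i x e) q = \sum_(i <- l) f i q *: T (h i) q.
Proof.
move=> TZ Sf Sh; elim: l => [|i l IH].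
  rewrite big_nil -[RHS]/((fun x => 0 : E x) q) -(form_linear0 TZ).
  congr (T _ q); apply/functional_extensionality_dep => x; apply/funext => e.
  by rewrite big_nil.
rewrite big_cons -IH.
have -> : (fun x (e : E x) => \sum_(j <- i :: l) f j x * h j x e) =
    combine_form (f i) (h i) (fun x e => \sum_(j <- l) f j x * h j x e).
  by apply/functional_extensionality_dep => x; apply/funext => e; rewrite big_cons.
by rewrite TZ//; exact: smooth_form_sum.
Qed.

(** The dual of [Cinf_linear_eq0]: phi^2 w is a combination of coordinate forms. One factor [phi]
    makes the coefficients globally smooth, the other makes the forms global, and the coefficients
    vanish at [q]. *)
Lemma form_linear_eq0 T q w : form_linear T ->
  smooth_form w -> (forall e, w q e = 0) -> T w q = 0.
Proof.
move=> TZ Sw wq0; have [t At tq] := trivs_cover E q.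
have ot := @tdom_open _ _ _ _ _ t.
have [phi [Sphi /nbhs_singleton phi1 phit]] := bump_function hM ot tq.
pose f i y := phi y *: w y (tinv t y (delta_mx 0 i)).
pose h i y (e : E y) := phi y * tmap t e 0 i.
have Sf i : smooth_fun (f i).
  apply: (smooth_on_cutoff ot openT Sphi phit).
  by rewrite setTI; have := Sw.2 t At (delta_mx 0 i); rewrite setIT.
have Sh i : smooth_form (h i).
  by apply: (smooth_form_cutoff ot Sphi phit); exact: smooth_coord_form.
have S2 : smooth_fun (fun y => phi y *: phi y) by apply: smooth_onZ => //; exact: openT.
have Efy : combine_form (fun y => phi y *: phi y) w (fun y e => 0) =
    fun y e => \sum_i f i y * h i y e.
  apply/functional_extensionality_dep => y; apply/funext => e.
  rewrite /combine_form addr0.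
  have [ty|nty] := pselect (tdom t y).
    rewrite [in LHS](tinv_decomp e ty) scalar_comb; last exact: Sw.1.
    rewrite mulr_sumr; apply: eq_bigr => i _.
    rewrite /f /h /GRing.scale/=; ring.
  have p0 : phi y = 0 by have [C [_ CU ->]] := phit => // /CU.
  by rewrite p0 scale0r mul0r big1// => i _; rewrite /f p0 scale0r mul0r.
have S0 := smooth_form0.
transitivity (T (combine_form (fun y => phi y *: phi y) w (fun y e => 0)) q).
  by rewrite TZ// form_linear0// /combine addr0 phi1 scale1r scale1r.
rewrite Efy form_linear_sum// big1// => i _.
by rewrite /f wq0 scaler0 scale0r.
Qed.

Lemma form_linear_comb T q w (c : 'I_r -> R) (h : 'I_r -> Defs.form E) :
  form_linear T -> smooth_form w -> (forall a, smooth_form (h a)) ->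
  (forall e, w q e = \sum_a c a * h a q e) ->
  T w q = \sum_a c a *: T (h a) q.
Proof.
move=> TZ Sw Sh wq.
have Sc a : smooth_fun (fun _ : M => c a) by exact: smooth_on_cst.
pose s y (e : E y) := \sum_a c a * h a y e.
have Ss : smooth_form s by exact: (smooth_form_sum _ Sc Sh).
have S1 : smooth_fun (fun _ : M => -1 : R) by exact: smooth_on_cst.
have z0 (e : E q) : combine_form (fun=> -1) s w e = 0.
  by rewrite /combine_form wq /s mulN1r addNr.
have := form_linear_eq0 TZ (smooth_form_combine S1 Ss Sw) z0.
rewrite TZ// /combine.
move=> /eqP; rewrite scaleN1r addrC subr_eq0 => /eqP ->.
exact: (form_linear_sum _ q TZ Sc Sh).
Qed.

End Bundle.

(** * Projected brackets *)

Section Curvature.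
Context {R : realType} {n r : nat} {M : smooth_manifold R n}.
Context {E : vector_bundle M r}.
Implicit Types (u v w z s : section E) (h : Defs.form E) (t : local_triv E r).

Lemma metric_scalarr (g : metric E) x (u : E x) : scalar (g x u).
Proof. by move=> a v w; rewrite !(Defs.metric_sym g u); exact: metric_scalar. Qed.

(** In a trivialization the pairing is the sum of u_i v_j g(e_i, e_j), and each factor is smooth. *)
Lemma pairing_smooth (g : metric E) u v :
  smooth_section u -> smooth_section v -> smooth_fun (pairing g u v).
Proof.
move=> Su Sv; apply: smooth_on_local => x _; have [t At tx] := trivs_cover E x.
exists (tdom t) => //; have ot := @tdom_open _ _ _ _ _ t.
have Sc s i : smooth_section s -> smooth_on (tdom t) (fun y => tmap t (s y) 0 i).
  by move=> Ss; apply: smooth_on_coord => //; have := Ss t At; rewrite setIT.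
pose e i y : E y := tinv t y (delta_mx 0 i).
have Sg i j := metric_smooth g At (delta_mx 0 i) (delta_mx 0 j).
apply: (smooth_on_ext ot _ (smooth_on_sum _ ot (fun i => smooth_onZ ot (Sc u i Su)
  (smooth_on_sum _ ot (fun j => smooth_onZ ot (Sc v j Sv) (Sg i j)))))) => y ty.
rewrite /pairing [in RHS](tinv_decomp (u y) ty).
rewrite (scalar_comb _ _ _ (metric_scalar g (v y))).
apply: eq_bigr => i _; rewrite [in RHS](tinv_decomp (v y) ty).
by rewrite (scalar_comb _ _ _ (metric_scalarr g _)).
Qed.

Lemma Cinf_linear_comp (S T : endo_op E) :
  Cinf_linear S -> Cinf_linear T -> Cinf_linear (S \o T).
Proof.
move=> [S1 S2] [T1 T2]; split=> [u /T1/S1//|f u v Sf Su Sv].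
by rewrite /= T2// S2//; exact: T1.
Qed.

Variables (rho : anchor E) (B : binary_op E) (L : locality_op E) (P : endo_op E).
Hypothesis hM : hausdorff_space M.
Hypothesis HB : R_bilinear B.
Hypothesis HL : Cinf_multilinear L.
Hypothesis HP : locality_projector rho L P.

Let PL : Cinf_linear P. Proof. by case: HP. Qed.

(** Additivity and homogeneity over functions come as separate axioms; f u + u' is read as 1 (f u) +
    u' to merge them. *)
Lemma connection_Cinf_linear (nabla : binary_op E) v : linear_connection rho nabla ->
  smooth_section v -> Cinf_linear (fun u => nabla u v).
Proof.
move=> [[N1 N2 _] _ N3] Sv; split=> [u Su|f u u' Sf Su Su']; first exact: N1.
have S1 : smooth_fun (fun _ : M => 1 : R) by exact: smooth_on_cst.
have Sfu : smooth_section (fun y => f y *: u y).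
  have := smooth_section_combine Sf Su (smooth_section_on0 setT).
  apply: smooth_section_on_ext; first exact: openT.
  by move=> x _; rewrite /combine addr0.
have -> : combine f u u' = combine (fun=> 1) (fun y => f y *: u y) u'.
  by apply/functional_extensionality_dep => x; rewrite /combine scale1r.
rewrite N2//; apply/functional_extensionality_dep => x.
by rewrite /combine N3// scale1r.
Qed.

Section OneConnection.
Variable nabla : binary_op E.
Hypothesis Hn : linear_connection rho nabla.

(** A connection is tensorial in its direction, so each correction term is tensorial in the frame
    slot, although not in [u]. *)
Lemma trace_linear_section h u v : smooth_form h -> smooth_section u ->
  smooth_section v -> Cinf_linear (fun s => P (L h (nabla s u) v)).
Proof.
move=> Sh Su Sv; case: HL => _ _ _ L4.
exact: Cinf_linear_comp PL (Cinf_linear_comp (L4 h v Sh Sv) (connection_Cinf_linear Hn Su)).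
Qed.

Lemma nabla_combine f u v w x : smooth_fun f -> smooth_section u ->
  smooth_section v -> smooth_section w ->
  nabla u (combine f v w) x =
  act rho u f x *: v x + f x *: nabla u v x + nabla u w x.
Proof.
move=> Sf Su Sv Sw; case: Hn => -[_ _ N3] N2 _.
have S1 : smooth_fun (fun _ : M => 1 : R) by exact: smooth_on_cst.
have Sfv : smooth_section (fun y => f y *: v y).
  have := smooth_section_combine Sf Sv (smooth_section_on0 setT).
  apply: smooth_section_on_ext; first exact: openT.
  by move=> y _; rewrite /combine addr0.
have -> : combine f v w = combine (fun=> 1) (fun y => f y *: v y) w.
  by apply/functional_extensionality_dep => y; rewrite /combine scale1r.
by rewrite N3// [LHS]/combine scale1r N2.
Qed.

Lemma nabla_smooth u v :
  smooth_section u -> smooth_section v -> smooth_section (nabla u v).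
Proof. by case: Hn => -[N1 _ _] _ _; exact: N1. Qed.

Lemma trace_linear_form s v : smooth_section s ->
  smooth_section v -> form_linear (fun h => P (L h s v)).
Proof.
move=> Ss Sv f h h' Sf Sh Sh'; case: HL => L1 L2 _ _.
by rewrite L2// PL.2//; exact: L1.
Qed.

Lemma trace_smooth h s v : smooth_form h -> smooth_section s ->
  smooth_section v -> smooth_section (P (L h s v)).
Proof. by move=> *; case: HL => L1 _ _ _; apply: PL.1; exact: L1. Qed.

(** The trace does not depend on the frame. If Y'_a is the sum over b of c_ab Y_b at [q], then h_b
    is the sum over a of c_ab h'_a; as both slots are tensorial, both traces equal the same double
    sum. Duality at the single point [q] suffices. *)
Lemma trace_change_frame q u v (h h' : 'I_r -> Defs.form E)
    (Y Y' : 'I_r -> section E) :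
  smooth_section u -> smooth_section v ->
  (forall a, smooth_form (h a)) -> (forall a, smooth_form (h' a)) ->
  (forall a, smooth_section (Y a)) -> (forall a, smooth_section (Y' a)) ->
  (forall e : E q, exists c : 'I_r -> R, e = \sum_a c a *: Y a q) ->
  (forall e : E q, exists c : 'I_r -> R, e = \sum_a c a *: Y' a q) ->
  (forall a b, h a q (Y b q) = (a == b)%:R) ->
  (forall a b, h' a q (Y' b q) = (a == b)%:R) ->
  \sum_a P (L (h' a) (nabla (Y' a) u) v) q =
  \sum_a P (L (h a) (nabla (Y a) u) v) q.
Proof.
move=> Su Sv Sh Sh' SY SY' BY BY' DY DY'.
have /choice[c Yc] : forall a, exists c : 'I_r -> R, Y' a q = \sum_b c b *: Y b q.
  by move=> a; exact: BY.
have lin k : smooth_form k -> scalar (k q : E q -> R) by move=> [lk _]; exact: lk.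
have sumD (d : 'I_r -> R) b : \sum_a d a * (b == a)%:R = d b.
  rewrite (bigD1 b)//= eqxx mulr1 big1 ?addr0// => a ab.
  by rewrite eq_sym (negbTE ab) mulr0.
(* Tested on e written in the frame Y' with coordinates d_a: both sides are the sum of d_a c_ab. *)
have hc b (e : E q) : h b q e = \sum_a c a b * h' a q e.
  have [d ->] := BY' e; rewrite scalar_comb; last exact: lin.
  apply: eq_bigr => a _; rewrite mulrC; congr (_ * _).
    rewrite Yc scalar_comb; last exact: lin.
    by under eq_bigr do rewrite DY; exact: sumD.
  rewrite scalar_comb; last exact: lin.
  by under eq_bigr do rewrite DY'; rewrite sumD.
transitivity (\sum_a \sum_b c a b *: P (L (h' a) (nabla (Y b) u) v) q).
  apply: eq_bigr => a _.
  exact: (Cinf_linear_comb hM (trace_linear_section (Sh' a) Su Sv) (SY' a) SY (Yc a)).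
rewrite exchange_big/=; apply: eq_bigr => b _; apply/esym.
apply: (form_linear_comb hM (trace_linear_form (nabla_smooth (SY b) Su) Sv) (Sh b) Sh').
exact: hc.
Qed.

Lemma projected_bracketE u v q : projected_bracket B L P nabla u v q =
  B u v q - \sum_a P (L (extend_form q ((framing q).2 a))
                        (nabla (extend q ((framing q).1 a)) u) v) q.
Proof. by rewrite /projected_bracket; case: framing. Qed.

End OneConnection.

(** The extensions agree near [p] with the local frame and coframe; having finitely many indices,
    they share one neighbourhood on which spanning and duality persist. *)
Lemma framing_extendP (p : M) :
  let Y a := extend p ((framing (E := E) p).1 a) in
  let h a := extend_form p ((framing (E := E) p).2 a) in
  [/\ forall a, smooth_section (Y a), forall a, smooth_form (h a) &
      \forall q \near p,
        (forall e : E q, exists c : 'I_r -> R, e = \sum_a c a *: Y a q) /\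
        (forall a b, h a q (Y b q) = (a == b)%:R)].
Proof.
have [U [Up [oU SX BX] DX]] := framingP (E := E) p.
move=> Y h.
have HY a := extendP hM oU Up (SX a).
have Hh a := extend_formP hM oU Up (DX a).1.
split=> [a|a|]; [exact: (HY a).1|exact: (Hh a).1|].
have nY : \forall q \near p, forall a, Y a q = (framing (E := E) p).1 a q.
  by apply: filter_forall => a; exact: (HY a).2.
have nh : \forall q \near p, forall a, h a q = (framing (E := E) p).2 a q.
  by apply: filter_forall => a; exact: (Hh a).2.
near=> q.
have Uq : U q by near: q; exact: open_nbhs_nbhs.
have Yq : forall a, Y a q = (framing (E := E) p).1 a q by near: q.
have hq : forall a, h a q = (framing (E := E) p).2 a q by near: q.
split=> [e|a b]; last by rewrite Yq hq (DX a).2.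
by have [c [-> _]] := BX q Uq e; exists c; apply: eq_bigr => a _; rewrite Yq.
Unshelve. all: by end_near. Qed.

(** The bracket is defined with a separately chosen framing at each point. Near [p] all of these may
    be replaced by the one chosen at [p], extended globally, which yields a smooth expression. *)
Lemma projected_bracket_smooth nabla u v : linear_connection rho nabla ->
  smooth_section u -> smooth_section v ->
  smooth_section (projected_bracket B L P nabla u v).
Proof.
move=> Hn Su Sv; apply: smooth_section_local => p.
have [SY Sh near_p] := framing_extendP p.
pose h a := extend_form p ((framing (E := E) p).2 a).
pose Y a := extend p ((framing (E := E) p).1 a).
pose T a := P (L (h a) (nabla (Y a) u) v).
have S1 a : smooth_fun (fun _ : M => a : R) by exact: smooth_on_cst.
have SB : smooth_section (B u v) by case: HB => + _ _; exact.
have ST a : smooth_section (T a).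
  exact: trace_smooth (Sh a) (nabla_smooth Hn (SY a) Su) Sv.
exists (combine (fun=> 1) (fun x => \sum_a (-1) *: T a x) (B u v)).
  apply: smooth_section_combine => //.
  exact: (smooth_section_sum _ (fun=> S1 (-1)) ST).
apply: filterS near_p => q [BY DY]; rewrite projected_bracketE /combine scale1r.
have [SY' Sh' near_q] := framing_extendP q.
have [BY' DY'] := nbhs_singleton near_q.
rewrite (trace_change_frame Hn Su Sv Sh Sh' SY SY' BY BY' DY DY').
by rewrite -scaler_sumr scaleN1r addrC.
Qed.

Lemma act_projected_bracket nabla u v f x : linear_connection rho nabla ->
  smooth_section u -> smooth_section v -> smooth_fun f ->
  act rho (projected_bracket B L P nabla u v) f x = act rho (B u v) f x.
Proof.
move=> Hn Su Sv Sf; rewrite /act projected_bracketE.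
have [SY Sh _] := framing_extendP x.
have lr := anchor_scalar rho (x := x) Sf.
pose F a : E x := P (L (extend_form x ((framing (E := E) x).2 a))
  (nabla (extend x ((framing (E := E) x).1 a)) u) v) x.
have F0 : rho x (\sum_a F a) f = 0.
  have -> : \sum_a F a = \sum_a 1 *: F a by apply: eq_bigr => a _; rewrite scale1r.
  have /= -> := scalar_comb (index_enum 'I_r) (fun=> 1) F lr.
  rewrite big1// => a _; rewrite mul1r; case: HP => _ HK _.
  exact: (HK _ _ _ (Sh a) (nabla_smooth Hn (SY a) Su) Sv f Sf x).
by rewrite addrC -scaleN1r lr/= F0 mulr0 add0r.
Qed.

(* The difference of the two brackets is tensorial in u and v. *)
Lemma projected_bracket_eq nabla nablas u v :
  linear_connection rho nabla -> linear_connection rho nablas ->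
  (forall p : M, exists (U : set M) (X : 'I_r -> section E),
     [/\ U p, local_frame U X,
         holonomic (projected_bracket B L P nabla) U X &
         holonomic (projected_bracket B L P nablas) U X]) ->
  smooth_section u -> smooth_section v ->
  projected_bracket B L P nabla u v = projected_bracket B L P nablas u v.
Proof.
move=> Hn Hs hol Su Sv; apply/functional_extensionality_dep => x.
have [SY Sh _] := framing_extendP x.
pose h a := extend_form x ((framing (E := E) x).2 a).
pose Y a := extend x ((framing (E := E) x).1 a).
have SYa a : smooth_section (Y a) := SY a.
(* The summands of the difference of the two brackets: the tensor [nablas] minus [nabla] goes into
   the middle slot, since the trace enters the bracket with a minus sign. *)
pose D a u v := P (L (h a) (combine (fun=> -1) (nabla (Y a) u) (nablas (Y a) u)) v).
have S1 : smooth_fun (fun _ : M => -1 : R) by exact: smooth_on_cst.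
have Sd a s : smooth_section s ->
    smooth_section (combine (fun=> -1) (nabla (Y a) s) (nablas (Y a) s)).
  move=> Ss.
  exact: smooth_section_combine S1 (nabla_smooth Hn (SY a) Ss) (nabla_smooth Hs (SY a) Ss).
have diffE s s' : smooth_section s -> smooth_section s' ->
    projected_bracket B L P nabla s s' x - projected_bracket B L P nablas s s' x
    = \sum_a D a s s' x.
  move=> Ss Ss'; rewrite !projected_bracketE opprB addrC addrA subrK -sumrB.
  apply: eq_bigr => a _; case: HL => _ _ _ L4; rewrite /D.
  have Sn := nabla_smooth Hn (SY a) Ss.
  have Sns := nabla_smooth Hs (SY a) Ss.
  have L4a := L4 _ _ (Sh a) Ss'.
  rewrite L4a.2// PL.2//; [|exact: L4a.1..].
  by rewrite /combine scaleN1r addrC.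
have Dr a s : smooth_section s -> Cinf_linear (D a s).
  move=> Ss; case: HL => _ _ L3 _.
  exact: Cinf_linear_comp PL (L3 _ _ (Sh a) (Sd a s Ss)).
(* The derivative terms [act rho (Y a) f] are the same for both connections and cancel in the
   difference, which is therefore tensorial in [s]. *)
have Dl a s' : smooth_section s' -> Cinf_linear (fun s => D a s s').
  move=> Ss'; case: HL => _ _ _ L4.
  apply: Cinf_linear_comp PL (Cinf_linear_comp (L4 _ _ (Sh a) Ss') _).
  split=> [s|f s t Sf Ss St]; first exact: Sd.
  apply/functional_extensionality_dep => y; rewrite /combine !scaleN1r.
  rewrite (nabla_combine Hn)// (nabla_combine Hs)//.
  rewrite opprD addrACA; congr (_ + _).
  by rewrite opprD addrACA addNr add0r scalerDr scalerN.
have [U [X [Ux [oU SX BX] hol1 hol2]]] := hol x.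
pose Z a := extend x (X a).
have HZ a := extendP hM oU Ux (SX a).
have SZ a : smooth_section (Z a) := (HZ a).1.
have BZ s : exists c : 'I_r -> R, s x = \sum_a c a *: Z a x.
  have [c [-> _]] := BX x Ux (s x); exists c; apply: eq_bigr => a _.
  by rewrite /Z (nbhs_singleton (HZ a).2).
apply/eqP; rewrite -subr_eq0 diffE//; apply/eqP.
have [c uc] := BZ u; have [d vd] := BZ v.
transitivity (\sum_a \sum_b \sum_k (c b * d k) *: D a (Z b) (Z k) x).
  apply: eq_bigr => a _.
  rewrite (Cinf_linear_comb hM (Dl a v Sv) Su SZ uc); apply: eq_bigr => b _.
  rewrite (Cinf_linear_comb hM (Dr a (Z b) (SZ b)) Sv SZ vd) scaler_sumr.
  by apply: eq_bigr => k _; rewrite scalerA.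
(* For fixed frame indices [b] and [k], the sum over [a] is again a difference of brackets, now of
   two shared frame sections, and both brackets vanish. *)
rewrite exchange_big big1//= => b _; rewrite exchange_big big1//= => k _.
by rewrite -scaler_sumr -diffE// hol1// hol2// subrr scaler0.
Qed.

End Curvature.

(** * The curvature identity for conjugate connections *)

Theorem proposition6p3 (R : realType) (n r : nat) (M : smooth_manifold R n)
    (M_hausdorff : hausdorff_space M) (M_paracompact : paracompact M)
    (M_orientable : orientable M)
    (E : vector_bundle M r) (rho : anchor E)
    (B : binary_op E) (L : locality_op E) (P : endo_op E)
    (g : metric E) (nabla nablas : binary_op E)
    (rho_regular : regular rho)
    (E_pre_leibniz : local_pre_leibniz rho B L)
    (P_projector : locality_projector rho L P)
    (g_conjugate : conjugate_structure rho g nabla nablas)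
    (shared_holonomic : forall p : M,
      exists (U : set M) (X : 'I_r -> section E),
        [/\ U p, local_frame U X,
            holonomic (projected_bracket B L P nabla) U X &
            holonomic (projected_bracket B L P nablas) U X])
    (u v w z : section E)
    (hu : smooth_section u) (hv : smooth_section v)
    (hw : smooth_section w) (hz : smooth_section z) (x : M) :
  pairing g (curvature B L P nabla u v w) z x
  + pairing g (curvature B L P nablas u v z) w x = 0.
Proof.
have [[HB HL _ _] Hpre] := E_pre_leibniz.
have [Hn Hs Hg] := g_conjugate.
have EK := projected_bracket_eq M_hausdorff HL P_projector Hn Hs
  shared_holonomic hu hv.
set K := projected_bracket B L P nabla u v.
have SK : smooth_section K.
  exact: (projected_bracket_smooth M_hausdorff HB HL P_projector Hn hu hv).
have SN a b : smooth_section a -> smooth_section b -> smooth_section (nabla a b).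
  by move=> Sa Sb; exact: (nabla_smooth Hn Sa Sb).
have SNs a b : smooth_section a -> smooth_section b -> smooth_section (nablas a b).
  by move=> Sa Sb; exact: (nabla_smooth Hs Sa Sb).
have Sp a b : smooth_section a -> smooth_section b -> smooth_fun (pairing g a b).
  by move=> Sa Sb; exact: (pairing_smooth g Sa Sb).
(* Compatibility used twice. The two mixed terms are exchanged when [a] and [b] are, so they cancel
   after antisymmetrization. *)
have second a b : smooth_section a -> smooth_section b ->
    act rho a (act rho b (pairing g w z)) x =
    (pairing g (nabla a (nabla b w)) z x + pairing g (nabla b w) (nablas a z) x)
    + (pairing g (nabla a w) (nablas b z) x
       + pairing g w (nablas a (nablas b z)) x).
  move=> Sa Sb.
  (* The factor 1 puts the sum into the shape of the linearity axiom for derivations. *)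
  have -> : act rho b (pairing g w z) = fun y =>
      1 * pairing g (nabla b w) z y + pairing g w (nablas b z) y.
    by apply/funext => y; rewrite Hg// mul1r.
  have [HD _] := anchor_derivation rho (a x).
  rewrite /act HD; [|exact: Sp (SN _ _ Sb hw) hz|exact: Sp hw (SNs _ _ Sb hz)].
  rewrite mul1r -[rho _ _ _]/(act rho a _ x) -[X in _ + X]/(act rho a _ x).
  by rewrite (Hg _ _ _ Sa (SN _ _ Sb hw) hz) (Hg _ _ _ Sa hw (SNs _ _ Sb hz)).
have first := act_projected_bracket B M_hausdorff P_projector x Hn hu hv (Sp w z hw hz).
(* Compatibility expands the derivative along [K], while the pre-Leibniz property turns the
   derivative along the bracket into a commutator of second derivatives. *)
move: first; rewrite -/K (Hg _ _ _ SK hw hz) (Hpre u v _ hu hv (Sp w z hw hz)).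
(* Equality of the brackets lets [K] serve in the curvature of [nablas] as well. *)
rewrite !second// /pairing /curvature -EK -/K => first.
have gB a (p q t : E a) : g a (p - q) t = g a p t - g a q t.
  by rewrite -scaleN1r [p + _]addrC (metric_scalar g) mulN1r addrC.
(* Once [w x] always stands first, the claim is a linear consequence of [first] in the values of the
   metric. *)
rewrite !gB !(Defs.metric_sym g _ (w x)).
lra.
Qed.
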